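(* Let $(d,m)$ and $a$ satisfy one of the following: (1) $d=4m-6$, $3\le m\le8$, $a=9$; (2) $d=4m-7$, $6\le m\le11$, $a=\frac{3(3m-7)}{m-3}$; (3) $d=4m-8$, $m\in\{11,12,13\}$, $a=\frac{3(3m-8)}{m-4}$. Then there exist nonnegative real numbers $\lambda_1,\lambda_2,\lambda_4,\lambda_5$ with $\lambda_1+\lambda_2+\lambda_4+\lambda_5=1$ such that $$\int_{\mathbb{S}^d}f\,d\bar\sigma=\lambda_1M_f\big(\tfrac1{\sqrt{d+1}}v_{d+1}\big)+\lambda_2M_f(v_1)+\lambda_4M_f\big(\tfrac1{\sqrt m}v_m\big)+\lambda_5M_f\Big(\tfrac1{\sqrt{a+d}}(\sqrt a,1,\dots,1)\Big)$$ for every polynomial $f$ in $d+1$ variables of degree at most $9$. In particular, positive cubature rules of degree $9$ on $\mathbb{S}^d$ of this form hold for $d=6,10,14,17,18,21,22,25,26,29,33,36,37,40,44$.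
   Context: $\mathbb{S}^d$ is the unit sphere of $\mathbb{R}^{d+1}$ and $\bar\sigma$ its rotation-invariant probability measure (normalized surface measure). $v_k=(1,\dots,1,0,\dots,0)\in\mathbb{R}^{d+1}$ ($k$ ones), and $(\sqrt a,1,\dots,1)\in\mathbb{R}^{d+1}$. For $y\in\mathbb{R}^{d+1}$, $M_f(y)$ denotes the average of $f$ over the set of distinct points obtained from $y$ by permuting coordinates and changing signs of coordinates arbitrarily. Orbits whose coefficient $\lambda_i$ vanishes are omitted from the rule. *)

(* Defs.v *)
From HB Require Import structures.
From mathcomp Require Import all_boot all_order all_fingroup all_algebra.
From mathcomp Require mpoly.

Set Implicit Arguments.
Unset Strict Implicit.
Unset Printing Implicit Defensive.

(* The notations of [mpoly] clash with those of the analysis library: [mpoly] is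
   imported only inside this module, and the analysis library after it. *)
Module Mpoly.
Import mpoly.

Definition poly (n : nat) (R : nzRingType) : Type := {mpoly R[n]}.

Definition eval (n : nat) (R : nzRingType) (f : poly n R) (x : n.-tuple R) : R :=
  f.@[tnth x].

(* [msize f] is the total degree plus one, and 0 for f = 0. *)
Definition degree_le (n : nat) (R : nzRingType) (k : nat) (f : poly n R) : bool :=
  (msize f <= k.+1)%N.

End Mpoly.

From mathcomp Require Import all_classical all_reals all_analysis.

Import Order.TTheory GRing.Theory Num.Theory.

Local Open Scope classical_set_scope.
Local Open Scope ring_scope.

Section Sphere.
Variables (R : realType) (n : nat).

(* Points of R^n are [n.-tuple R], which carries the product sigma-algebra,
   i.e. the Borel one. *)
Definition sphere : set (n.-tuple R) :=
  [set x | \sum_(i < n) tnth x i ^+ 2 = 1].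

Definition rotation (Q : 'M[R]_n) : Prop := Q *m Q^T = 1%:M /\ \det Q = 1.

Definition mxact (Q : 'M[R]_n) (x : n.-tuple R) : n.-tuple R :=
  [tuple \sum_(j < n) Q i j * tnth x j | i < n].

(* The sphere carries exactly one rotation-invariant Borel probability measure
   when n >= 2, namely normalized surface measure; here it is seen as a measure
   on R^n concentrated on the sphere. *)
Definition uniform_on_sphere (sigma : probability (n.-tuple R) R) : Prop :=
  sigma sphere = 1%E /\
  forall Q : 'M[R]_n, rotation Q ->
  forall A : set (n.-tuple R), measurable A ->
    sigma (mxact Q @^-1` A) = sigma A.

Definition signed_perm_act (y : n.-tuple R)
    (g : {perm 'I_n} * {ffun 'I_n -> bool}) : n.-tuple R :=
  [tuple (-1) ^+ g.2 i * tnth y (g.1 i) | i < n].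

(* [undup]: distinct signed permutations may give the same point, and each
   point of the orbit is counted once. *)
Definition orbit_points (y : n.-tuple R) : seq (n.-tuple R) :=
  undup (codom (signed_perm_act y)).

Definition orbit_avg (f : Mpoly.poly n R) (y : n.-tuple R) : R :=
  (\sum_(z <- orbit_points y) Mpoly.eval f z) / (size (orbit_points y))%:R.

Definition scale_pt (c : R) (x : n.-tuple R) : n.-tuple R :=
  [tuple c * tnth x i | i < n].

Definition vpt (k : nat) : n.-tuple R := [tuple ((i < k)%N)%:R | i < n].

Definition apt (a : R) : n.-tuple R :=
  [tuple if (i : nat) == 0%N then Num.sqrt a else 1 | i < n].

End Sphere.

Arguments vpt {R} n k.
Arguments apt {R} n a.

(* No truncation occurs in the natural-number subtractions. *)
Definition admissible (R : realType) (d m : nat) (a : R) : Prop :=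
  [\/ [/\ d = (4 * m - 6)%N, (3 <= m <= 8)%N & a = 9],
      [/\ d = (4 * m - 7)%N, (6 <= m <= 11)%N
        & a = 3 * (3 * m%:R - 7) / (m%:R - 3)]
    | [/\ d = (4 * m - 8)%N, m \in [:: 11; 12; 13]%N
        & a = 3 * (3 * m%:R - 8) / (m%:R - 4)]].

Definition cubature9 (R : realType) (d m : nat) (a l1 l2 l4 l5 : R) : Prop :=
  forall sigma : probability (d.+1.-tuple R) R, uniform_on_sphere sigma ->
  forall f : Mpoly.poly d.+1 R, Mpoly.degree_le 9 f ->
  (\int[sigma]_(x in @sphere R d.+1) (Mpoly.eval f x)%:E =
   (l1 * orbit_avg f (scale_pt (Num.sqrt d.+1%:R)^-1 (vpt d.+1 d.+1))
    + l2 * orbit_avg f (vpt d.+1 1)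
    + l4 * orbit_avg f (scale_pt (Num.sqrt m%:R)^-1 (vpt d.+1 m))
    + l5 * orbit_avg f (scale_pt (Num.sqrt (a + d%:R))^-1 (apt d.+1 a)))%:E)%E.

Definition positive_cubature9 (R : realType) (d m : nat) (a : R) : Prop :=
  exists l1 l2 l4 l5 : R,
    [/\ 0 <= l1, 0 <= l2, 0 <= l4 & 0 <= l5] /\
    l1 + l2 + l4 + l5 = 1 /\
    cubature9 d m a l1 l2 l4 l5.

(* Main.v *)
(* Both sides of the rule are determined by moments that vanish as soon as one
   exponent is odd, are invariant under exchange of coordinates, and satisfy
   sum_i mu(e + 2 e_i) = mu(e) because sum_i x_i^2 = 1 on the sphere.  In degree
   at most 9 such moments are determined by mu(1) and the moments of the
   invariants p4, p6, p8 and p4^2, where p_k = sum_i x_i^k (the invariants of the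
   hyperoctahedral group, modulo p2 = 1).  For the uniform measure these follow
   from invariance under rotations of a coordinate plane; on an orbit p_k is
   constant.  So the rule amounts to five equations in four weights, and with
   a = 3 (n - 1 - m) / (n + 3 - 3 m), n = d + 1, they hold identically in n and m:
   the three cases are n = 4m - 5, 4m - 6, 4m - 7, and the ranges of m are those
   where the weights are nonnegative. *)

Require Import Defs.
From mathcomp Require Import all_boot all_order all_fingroup all_algebra.
From mathcomp Require mpoly.

Set Implicit Arguments.
Unset Strict Implicit.
Unset Printing Implicit Defensive.

(** * Expansion of polynomials into monomials *)

Module PolynomialExpansion.
Import mpoly.
Import GRing.Theory.
Local Open Scope ring_scope.

(** Exponents become plain functions here, so that everything after the analysis library is loaded
    can do without the notations of [mpoly]. *)
Lemma eval_sum_monomials (R : comNzRingType) (n k : nat) (f : Mpoly.poly n R) :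
  Mpoly.degree_le k f ->
  exists (N : nat) (c : 'I_N -> R) (e : 'I_N -> 'I_n -> nat),
    (forall i, \sum_j e i j <= k)%N /\
    (forall x : n.-tuple R,
       Mpoly.eval f x = \sum_i c i * \prod_j tnth x j ^+ e i j).
Proof.
move=> degf; exists (size (msupp f)).
exists (fun i => f@_(nth 0%MM (msupp f) i)), (fun i => nth 0%MM (msupp f) i).
split=> [i|x]; last by rewrite /Mpoly.eval mevalE (big_nth 0%MM) big_mkord.
rewrite -mdegE -ltnS; apply: leq_trans degf.
by apply: msize_mdeg_lt; rewrite mem_nth.
Qed.

End PolynomialExpansion.

From mathcomp Require Import all_classical all_reals all_analysis.
From mathcomp Require Import measurable_realfun ring lra zify.

Import Order.TTheory GRing.Theory Num.Theory.

Local Open Scope ring_scope.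

(** * Exponent vectors *)

Section Exponents.
Variable n : nat.
Implicit Types (b g : 'I_n -> nat) (i j : 'I_n).

Definition single (k : nat) i : 'I_n -> nat := fun j => if j == i then k else 0%N.

Definition addexp b g : 'I_n -> nat := fun j => (b j + g j)%N.

(** Exponent vectors with only even entries are handled through their halves. *)
Definition dblexp b : 'I_n -> nat := fun j => (b j).*2.

Lemma single_tperm k i i1 i2 : single k i \o tperm i1 i2 = single k (tperm i1 i2 i).
Proof.
apply/funext => j; rewrite /single /=.
by rewrite -(inj_eq (@perm_inj _ (tperm i1 i2))) tpermK.
Qed.

Lemma addexp_single k l i : addexp (single k i) (single l i) = single (k + l) i.
Proof. by apply/funext => j; rewrite /addexp /single; case: ifP. Qed.

Lemma sum_single k i : (\sum_j single k i j)%N = k.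
Proof. by rewrite /single -big_mkcond /= big_pred1_eq. Qed.

Lemma sum_addexp b g : (\sum_j addexp b g j)%N = (\sum_j b j + \sum_j g j)%N.
Proof. exact: big_split. Qed.

Lemma sum_dblexp b : (\sum_j dblexp b j)%N = (\sum_j b j).*2.
Proof. by rewrite -mul2n big_distrr /=; apply: eq_bigr => j _; rewrite mul2n. Qed.

Lemma dblexp_single k i : dblexp (single k i) = single k.*2 i.
Proof. by apply/funext => j; rewrite /dblexp /single; case: ifP. Qed.

Lemma dblexp_add b g : dblexp (addexp b g) = addexp (dblexp b) (dblexp g).
Proof. by apply/funext => j; rewrite /dblexp /addexp doubleD. Qed.

End Exponents.

(** * Vanishing of symmetric functionals on even exponents *)

Section EvenMoments.
Variables (R : numFieldType) (n : nat).
(** [nu b] models the difference of two moments at the exponents [dblexp b]; raising an entry of [b]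
    by one multiplies the monomial by the square of a coordinate. *)
Variable nu : ('I_n -> nat) -> R.
Implicit Types (b g : 'I_n -> nat) (i j : 'I_n).

Hypothesis nu_tperm : forall b i j, nu (b \o tperm i j) = nu b.
Hypothesis nu_sum : forall b, \sum_i nu (addexp b (single 1 i)) = nu b.

Lemma nu_single k i j : nu (single k i) = nu (single k j).
Proof. by rewrite -(nu_tperm _ i j) single_tperm tpermL. Qed.

Lemma sum_nu_single k i : \sum_j nu (single k j) = n%:R * nu (single k i).
Proof.
rewrite (eq_bigr (fun=> nu (single k i))) => [|j _]; last exact: nu_single.
by rewrite sumr_const card_ord mulr_natl.
Qed.

Lemma nu_pair k l i j i0 j0 : i != j -> i0 != j0 ->
  nu (addexp (single k i) (single l j)) = nu (addexp (single k i0) (single l j0)).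
Proof.
have pairE b g a c :
  addexp b g \o tperm a c = addexp (b \o tperm a c) (g \o tperm a c) by [].
move=> ij ij0; rewrite -(nu_tperm _ i i0) pairE !single_tperm tpermL.
(* Exchanging [i] with [i0] turns [j] into [j']. Both [j'] and [j0] differ from [i0], so the second
   exchange fixes [i0]. *)
set j' := tperm i i0 j; have j'i0 : j' != i0.
  by rewrite -(tpermL i i0) (inj_eq perm_inj) eq_sym.
by rewrite -(nu_tperm _ j' j0) pairE !single_tperm tpermL tpermD // eq_sym.
Qed.

Lemma sum_nu_pair k i j : i != j ->
  \sum_i' \sum_j' nu (addexp (single k i') (single k j')) =
  n%:R * (nu (single (k + k) i) + (n%:R - 1) * nu (addexp (single k i) (single k j))).
Proof.
move=> ij; rewrite (eq_bigr (fun=> nu (single (k + k) i) +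
  (n%:R - 1) * nu (addexp (single k i) (single k j)))).
  by rewrite sumr_const card_ord mulr_natl.
move=> i' _; rewrite (bigD1 i') //= addexp_single (nu_single _ _ i); congr (_ + _).
rewrite (eq_bigr (fun=> nu (addexp (single k i) (single k j)))).
  rewrite sumr_const cardC1 card_ord.
  by rewrite -subn1 -[LHS]mulr_natl natrB // (leq_ltn_trans _ (ltn_ord i)).
by move=> j' j'i'; apply: nu_pair; rewrite // eq_sym.
Qed.

Lemma natr_ord_neq0 i : n%:R != 0 :> R.
Proof. by rewrite pnatr_eq0; case: (n) i => [[]|]. Qed.

(** In terms of the doubled exponents these hypotheses concern 1, p4, p6, p8 and p4^2, in this
    order. *)
Hypothesis nu0 : nu (fun=> 0%N) = 0.
Hypothesis nu2 : \sum_i nu (single 2 i) = 0.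
Hypothesis nu3 : \sum_i nu (single 3 i) = 0.
Hypothesis nu4 : \sum_i nu (single 4 i) = 0.
Hypothesis nu22 : \sum_i \sum_j nu (addexp (single 2 i) (single 2 j)) = 0.

Lemma nu_single0 k i : (1 < k <= 4)%N -> nu (single k i) = 0.
Proof.
move=> /andP[k1 k4]; apply: (mulfI (natr_ord_neq0 i)).
rewrite mulr0 -sum_nu_single.
by case: k k1 k4 => [|[|[|[|[|k]]]]].
Qed.

Lemma nu_pair0 i j : i != j -> nu (addexp (single 2 i) (single 2 j)) = 0.
Proof.
move=> ij; have := nu22; rewrite (sum_nu_pair _ ij) nu_single0 // add0r mulrA.
move/eqP; rewrite mulf_eq0 => /orP[|/eqP //].
(* The factor n - 1 is nonzero, because [i] and [j] are distinct indices. *)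
rewrite mulf_eq0 (negPf (natr_ord_neq0 i)) /= subr_eq0 (eqr_nat _ n 1) => /eqP n1.
by case/eqP: ij; apply: val_inj; have := ltn_ord i; have := ltn_ord j; rewrite /=; lia.
Qed.

(** Nonzero entries are at least 2, so degree 4 leaves only the zero vector, a single entry, or two
    entries equal to 2. *)
Lemma nu_no_one b : (\sum_i b i <= 4)%N -> (forall i, b i != 1%N) -> nu b = 0.
Proof.
move=> deg b1; have bge i : b i != 0%N -> (2 <= b i)%N.
  by have := b1 i; case: (b i) => [|[]].
have [/existsP[i bi]|/existsPn b0] := boolP [exists i, b i != 0%N]; last first.
  rewrite (_ : b = fun=> 0%N) //; apply/funext => i.
  by apply/eqP; have := b0 i; rewrite negbK.
have [/existsP[j /andP[ji bj]]|/existsPn b0] :=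
    boolP [exists j, (j != i) && (b j != 0%N)]; last first.
  have bE : b = single (b i) i.
    apply/funext => j; rewrite /single; case: eqVneq => [->//|ji].
    by apply/eqP; have := b0 j; rewrite ji negbK.
  rewrite bE nu_single0 // bge //=.
  by apply: leq_trans deg; rewrite (bigD1 i) //= leq_addr.
have := deg; rewrite (bigD1 i) //= (bigD1 j) //=.
have := bge _ bi; have := bge _ bj.
set S := (\sum_(_ < _ | _) _)%N => bj2 bi2 bij.
have S0 : S = 0%N by lia.
rewrite (_ : b = addexp (single 2 i) (single 2 j)) ?nu_pair0 // 1?eq_sym //.
apply/funext => l; rewrite /addexp /single.
case: eqVneq => [->|li]; first by rewrite eq_sym (negPf ji); lia.
case: eqVneq => [->|lj]; first by lia.
by move/eqP: S0; rewrite sum_nat_eq0 => /forallP/(_ l)/implyP/(_ _)/eqP; apply; rewrite li.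
Qed.

(* If [b i0 = 1], lower that entry to get [g].  In the sum rule for [g] the
   terms raising a zero entry all equal [nu b], and the others have smaller
   support than [b]; so one may eliminate the entries equal to 1. *)
Lemma even_moments_vanish b : (\sum_i b i <= 4)%N -> nu b = 0.
Proof.
(* Outer induction on the size of the support, inner induction on the degree. *)
have [s] := ubnP #|[set i | b i != 0%N]|; elim: s b => // s IHs b.
have [k] := ubnP (\sum_i b i)%N.
elim: k b => // k IHk b bk bs b4.
have [/existsP[i0 /eqP bi0]|/existsPn b1] := boolP [exists i, b i == 1%N]; last first.
  exact: nu_no_one.
pose g j := if j == i0 then 0%N else b j.
have bE : b = addexp g (single 1 i0).
  apply/funext => j; rewrite /addexp /g /single.
  by case: eqVneq => [->|_]; rewrite ?addn0.
have degE : (\sum_j b j = (\sum_j g j).+1)%N by rewrite bE sum_addexp sum_single addn1.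
have suppg : [set i | g i != 0%N] = [set i | b i != 0%N] :\ i0.
  by apply/finset.setP => i; rewrite !inE /g; case: (eqVneq i i0).
have cardg : (#|[set i | g i != 0%N]| < s)%N.
  by move: bs; rewrite (cardsD1 i0) inE bi0 suppg.
have g0 : nu g = 0 by apply: IHk; lia.
have := nu_sum g; rewrite g0 (bigID (fun i => g i == 0%N)) /=.
rewrite [X in _ + X]big1 => [|i gi]; last first.
  apply: IHs; last by rewrite sum_addexp sum_single addn1 -degE.
  rewrite (_ : [set _ | _] = [set i | g i != 0%N]) //.
  apply/finset.setP => j; rewrite !inE /addexp /single.
  by case: (eqVneq j i) => [->|_]; rewrite ?addn0 // addn1 gi.
rewrite addr0 (eq_bigr (fun=> nu b)) => [|i /eqP gi]; last first.
  rewrite bE -(nu_tperm _ i i0); congr nu; apply/funext => j.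
  rewrite /addexp /= -[single 1 i _]/((single 1 i \o _) j) single_tperm tpermL.
  congr (_ + _)%N; case: tpermP => [->|->|//]; by rewrite gi /g eqxx.
(* What remains is a multiple of [nu b] by the number of zero entries of [g], which is positive
   since [i0] is one of them. *)
rewrite sumr_const => /eqP; rewrite mulrn_eq0 => /orP[/eqP/card0_eq/(_ i0)|/eqP //].
by rewrite unfold_in /g /= eqxx.
Qed.

End EvenMoments.

(** * Monomial functions *)

Definition monom (R : comNzRingType) (n : nat) (e : 'I_n -> nat) (x : n.-tuple R) : R :=
  \prod_i tnth x i ^+ e i.

Section Monomials.
Variables (R : comNzRingType) (n : nat).
Implicit Types (e f : 'I_n -> nat) (x : n.-tuple R).

Lemma monom_addexp e f x : monom (addexp e f) x = monom e x * monom f x.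
Proof. by rewrite -big_split; apply: eq_bigr => i _; rewrite exprD. Qed.

Lemma monom_single k i x : monom (single k i) x = tnth x i ^+ k.
Proof.
rewrite /monom (bigD1 i) //= /single eqxx big1 ?mulr1 // => j /negPf->.
by rewrite expr0.
Qed.

Lemma monom0 x : monom (fun=> 0%N) x = 1.
Proof. by rewrite /monom big1. Qed.

Lemma monom_tperm e i j x :
  monom (e \o tperm i j) x = monom e [tuple tnth x (tperm i j k) | k < n].
Proof.
rewrite /monom (reindex_inj (@perm_inj _ (tperm i j))); apply: eq_bigr => k _.
by rewrite /= tpermK tnth_mktuple.
Qed.

End Monomials.

(** * Comparison of two symmetric moment functionals *)

Section SphereMoments.
Variables (R : numFieldType) (n : nat).
Implicit Types (mu : ('I_n -> nat) -> R) (e : 'I_n -> nat).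

(* The properties, up to degree [k], of the moments of a measure on the unit
   sphere that is symmetric under sign changes and exchanges of coordinates. *)
Definition symmetric_sphere_moments k mu :=
  [/\ (forall e i, odd (e i) -> (\sum_j e j <= k)%N -> mu e = 0),
      (forall e i j, mu (dblexp e \o tperm i j) = mu (dblexp e))
    & (forall e, \sum_i mu (addexp e (single 2 i)) = mu e)].

(** An odd exponent makes both sides zero. On even exponents the difference, as a function of the
    halved exponents, satisfies the hypotheses of [even_moments_vanish]; a degree of at most 9
    becomes at most 4 after halving. *)
Lemma symmetric_sphere_moments_eq mu mu' :
  symmetric_sphere_moments 9 mu -> symmetric_sphere_moments 9 mu' ->
  mu (fun=> 0%N) = mu' (fun=> 0%N) ->
  \sum_i mu (single 4 i) = \sum_i mu' (single 4 i) ->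
  \sum_i mu (single 6 i) = \sum_i mu' (single 6 i) ->
  \sum_i mu (single 8 i) = \sum_i mu' (single 8 i) ->
  \sum_i \sum_j mu (addexp (single 4 i) (single 4 j)) =
    \sum_i \sum_j mu' (addexp (single 4 i) (single 4 j)) ->
  forall e, (\sum_i e i <= 9)%N -> mu e = mu' e.
Proof.
move=> [mu_odd mu_perm mu_sum] [mu_odd' mu_perm' mu_sum'] eq0 eq4 eq6 eq8 eq44 e e9.
have [/existsP[i oi]|/existsPn eve] := boolP [exists i, odd (e i)].
  by rewrite (mu_odd _ i) // (mu_odd' _ i).
have -> : e = dblexp (fun i => (e i)./2).
  by apply/funext => i; rewrite /dblexp halfK (negPf (eve i)) subn0.
apply/eqP; rewrite -subr_eq0; apply/eqP.
pose nu b := mu (dblexp b) - mu' (dblexp b).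
apply: (@even_moments_vanish _ _ nu).
- by move=> b i j; rewrite /nu mu_perm mu_perm'.
- move=> b; rewrite /nu sumrB -mu_sum -(mu_sum' (dblexp b)).
  by congr (_ - _); apply: eq_bigr => i _; rewrite dblexp_add dblexp_single.
- by rewrite /nu -[dblexp _]/(fun=> 0%N) eq0 subrr.
- rewrite sumrB; under eq_bigr do rewrite dblexp_single.
  by rewrite eq4 -sumrB big1 // => i _; rewrite dblexp_single subrr.
- rewrite sumrB; under eq_bigr do rewrite dblexp_single.
  by rewrite eq6 -sumrB big1 // => i _; rewrite dblexp_single subrr.
- rewrite sumrB; under eq_bigr do rewrite dblexp_single.
  by rewrite eq8 -sumrB big1 // => i _; rewrite dblexp_single subrr.
- under eq_bigr => i _.
    under eq_bigr do rewrite /nu dblexp_add !dblexp_single.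
    rewrite sumrB; over.
  by rewrite sumrB eq44 subrr.
- have := e9; rewrite (_ : \sum_i e i = (\sum_i (e i)./2).*2)%N; first by lia.
  rewrite -sum_dblexp; apply: eq_bigr => i _.
  by rewrite /dblexp halfK (negPf (eve i)) subn0.
Qed.

Lemma symmetric_sphere_moments_lincomb k (I : finType) (t : I -> R)
    (mu : I -> ('I_n -> nat) -> R) :
  (forall a, symmetric_sphere_moments k (mu a)) ->
  symmetric_sphere_moments k (fun e => \sum_a t a * mu a e).
Proof.
move=> mu_sym; split.
- move=> e i oi ek; apply: big1 => a _; have [mu_odd _ _] := mu_sym a.
  by rewrite (mu_odd _ i) // mulr0.
- by move=> e i j; apply: eq_bigr => a _; have [_ -> _] := mu_sym a.
- move=> e; rewrite exchange_big; apply: eq_bigr => a _.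
  by rewrite -mulr_sumr; have [_ _ ->] := mu_sym a.
Qed.

End SphereMoments.

(** * Moments of orbit averages *)

Section OrbitMoments.
Variables (R : realType) (n : nat).
Implicit Types (x y z : n.-tuple R) (e : 'I_n -> nat).

Definition power_sum k x : R := \sum_i tnth x i ^+ k.

Lemma signed_perm_act_comp y g h : exists k,
  signed_perm_act (signed_perm_act y g) h = signed_perm_act y k.
Proof.
exists (h.1 * g.1, [ffun i => h.2 i (+) g.2 (h.1 i)])%g.
apply: eq_from_tnth => i; rewrite !tnth_mktuple /= ffunE permM mulrA.
by rewrite signr_addb.
Qed.

Lemma signed_perm_act_inj g : injective (fun y => signed_perm_act y g).
Proof.
move=> y z yz; apply: eq_from_tnth => i.
have /(congr1 (fun x => tnth x (g.1^-1%g i))) := yz.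
by rewrite !tnth_mktuple permKV => /(mulfI (negbT (signr_eq0 _ _))).
Qed.

Lemma power_sum_orbit k y z : z \in orbit_points y ->
  power_sum k.*2 z = power_sum k.*2 y.
Proof.
rewrite mem_undup => /codomP[g ->]; rewrite /power_sum [RHS](reindex_inj (@perm_inj _ g.1)).
apply: eq_bigr => i _; rewrite tnth_mktuple exprMn -exprM.
by rewrite -signr_odd oddM odd_double andbF mul1r.
Qed.

(** Extends [orbit_avg] from polynomials to arbitrary functions, such as composites with a signed
    permutation. *)
Definition fun_orbit_avg (F : n.-tuple R -> R) y : R :=
  (\sum_(z <- orbit_points y) F z) / (size (orbit_points y))%:R.

(** The action of [g] is injective and maps the duplicate-free list [orbit_points y] into itself,
    hence permutes it. *)
Lemma fun_orbit_avg_act F y g :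
  fun_orbit_avg (fun z => F (signed_perm_act z g)) y = fun_orbit_avg F y.
Proof.
congr (_ / _); rewrite -(big_map (fun z => signed_perm_act z g) xpredT).
apply: perm_big; have um : uniq (map (fun z => signed_perm_act z g) (orbit_points y)).
  by rewrite map_inj_uniq ?undup_uniq //; apply: signed_perm_act_inj.
have sub : {subset map (fun z => signed_perm_act z g) (orbit_points y) <= orbit_points y}.
  move=> _ /mapP[z + ->]; rewrite !mem_undup => /codomP[h ->].
  by have [k ->] := signed_perm_act_comp y h g; apply: codom_f.
apply: uniq_perm => //; first exact: undup_uniq.
by have [] := uniq_min_size um sub _; rewrite ?size_map.
Qed.

Lemma size_orbit_points_gt0 y : (0 < size (orbit_points y))%N.
Proof.
rewrite -has_predT; apply/hasP; exists (signed_perm_act y (1%g, [ffun=> false])) => //.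
by rewrite mem_undup codom_f.
Qed.

Lemma fun_orbit_avg_cst F y c : (forall z, z \in orbit_points y -> F z = c) ->
  fun_orbit_avg F y = c.
Proof.
move=> Fc; rewrite /fun_orbit_avg big_seq (eq_bigr (fun=> c)) // -big_seq.
rewrite big_const_seq count_predT iter_addr_0 -[c *+ _]mulr_natr mulfK //.
by rewrite pnatr_eq0 -lt0n size_orbit_points_gt0.
Qed.

Lemma eq_fun_orbit_avg F G y : {in orbit_points y, F =1 G} ->
  fun_orbit_avg F y = fun_orbit_avg G y.
Proof. by move=> FG; congr (_ / _); rewrite big_seq [RHS]big_seq; apply: eq_bigr. Qed.

Lemma fun_orbit_avg_sum (I : finType) (F : I -> n.-tuple R -> R) y :
  fun_orbit_avg (fun z => \sum_i F i z) y = \sum_i fun_orbit_avg (F i) y.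
Proof. by rewrite /fun_orbit_avg exchange_big mulr_suml. Qed.

Lemma fun_orbit_avgZ c F y :
  fun_orbit_avg (fun z => c * F z) y = c * fun_orbit_avg F y.
Proof. by rewrite /fun_orbit_avg -mulr_sumr mulrA. Qed.

Definition orbit_moment y e : R := fun_orbit_avg (monom e) y.

Lemma orbit_moment0 y : orbit_moment y (fun=> 0%N) = 1.
Proof. by apply: fun_orbit_avg_cst => z _; rewrite monom0. Qed.

Lemma orbit_symmetric_moments k y : power_sum 2 y = 1 ->
  symmetric_sphere_moments k (orbit_moment y).
Proof.
move=> y1; split.
- move=> e i oi _; apply/eqP; rewrite -eqNr; apply/eqP.
  (* Flipping the sign of coordinate [i] alone negates the monomial, so its average equals its own
     opposite. *)
  rewrite -[RHS](fun_orbit_avg_act _ _ (1%g, [ffun j => j == i])).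
  rewrite -mulN1r -fun_orbit_avgZ; apply: eq_fun_orbit_avg => z _.
  rewrite /monom [RHS](bigD1 i) // [in LHS](bigD1 i) //=.
  rewrite tnth_mktuple ffunE eqxx perm1.
  rewrite mulrA expr1 exprMn -[(-1) ^+ e i]signr_odd oi expr1.
  congr (_ * _); apply: eq_bigr => j /negPf ji.
  by rewrite tnth_mktuple ffunE ji perm1 mul1r.
- move=> e i j; rewrite -[RHS](fun_orbit_avg_act _ _ (tperm i j, [ffun=> false])).
  apply: eq_fun_orbit_avg => z _; rewrite monom_tperm; congr monom.
  by apply: eq_from_tnth => l; rewrite !tnth_mktuple ffunE mul1r.
- move=> e; rewrite -fun_orbit_avg_sum; apply: eq_fun_orbit_avg => z zy.
  under eq_bigr do rewrite monom_addexp monom_single.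
  by rewrite -mulr_sumr -/(power_sum 2 z) (power_sum_orbit 1 zy) y1 mulr1.
Qed.

Lemma sum_orbit_moment_single k y :
  \sum_i orbit_moment y (single k.*2 i) = power_sum k.*2 y.
Proof.
rewrite -fun_orbit_avg_sum; apply: fun_orbit_avg_cst => z zy.
by under eq_bigr do rewrite monom_single; rewrite -(power_sum_orbit k zy).
Qed.

Lemma sum_orbit_moment_pair k y :
  \sum_i \sum_j orbit_moment y (addexp (single k.*2 i) (single k.*2 j)) =
  power_sum k.*2 y ^+ 2.
Proof.
under eq_bigr do rewrite -fun_orbit_avg_sum.
rewrite -fun_orbit_avg_sum; apply: fun_orbit_avg_cst => z zy.
rewrite -(power_sum_orbit k zy) expr2 [RHS]mulr_suml; apply: eq_bigr => i _.
rewrite mulr_sumr; apply: eq_bigr => j _.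
by rewrite monom_addexp !monom_single.
Qed.

End OrbitMoments.

(** * Rotations of a coordinate plane *)

Section Givens.
Variables (R : realType) (n : nat).
Implicit Types (i j : 'I_n) (c s u v : R) (x : n.-tuple R).

(** [c] and [s] are not tied by c^2 + s^2 = 1, so that the formulas for products and transposes are
    plain polynomial identities. *)
Definition givens i j c s : 'M[R]_n :=
  \matrix_(k, l) if k == i then c * (l == i)%:R + s * (l == j)%:R
                 else if k == j then c * (l == j)%:R - s * (l == i)%:R
                 else (l == k)%:R.

Lemma mxact_givens i j c s x : mxact (givens i j c s) x =
  [tuple if k == i then c * tnth x i + s * tnth x j
         else if k == j then c * tnth x j - s * tnth x i
         else tnth x k | k < n].
Proof.
have delta k : \sum_l (l == k)%:R * tnth x l = tnth x k.
  rewrite (bigD1 k) //= eqxx mul1r big1 ?addr0 // => l /negPf->.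
  by rewrite mul0r.
apply: eq_from_tnth => k; rewrite !tnth_mktuple.
under eq_bigr do rewrite mxE.
case: eqP => [_|_]; last case: eqP => [_|_] //.
- under eq_bigr do rewrite mulrDl -!mulrA.
  by rewrite big_split /= -!mulr_sumr !delta.
- under eq_bigr do rewrite mulrBl -!mulrA.
  by rewrite sumrB -!mulr_sumr !delta.
Qed.

(** Basis vectors pick out columns, so matrices may be compared through their action on points. *)
Lemma mxact_inj (A B : 'M[R]_n) : mxact A =1 mxact B -> A = B.
Proof.
move=> AB; apply/matrixP => k l.
have /(congr1 (fun x => tnth x k)) := AB [tuple (i == l)%:R | i < n].
have actE (Q : 'M[R]_n) : tnth (mxact Q [tuple (i == l)%:R | i < n]) k = Q k l.
  rewrite tnth_mktuple (bigD1 l) //= tnth_mktuple eqxx mulr1 big1 ?addr0 //.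
  by move=> i /negPf il; rewrite tnth_mktuple il mulr0.
by rewrite !actE.
Qed.

Lemma mxact_mul (A B : 'M[R]_n) x : mxact (A *m B) x = mxact A (mxact B x).
Proof.
apply: eq_from_tnth => k; rewrite !tnth_mktuple.
under eq_bigr do rewrite mxE mulr_suml.
rewrite exchange_big; apply: eq_bigr => l _; rewrite tnth_mktuple mulr_sumr.
by apply: eq_bigr => m _; rewrite mulrA.
Qed.

(** The parameters multiply like complex numbers with real parts [c], [u] and imaginary parts [s],
    [v]. *)
Lemma givens_mul i j c s u v : i != j ->
  givens i j c s *m givens i j u v = givens i j (c * u - s * v) (c * v + s * u).
Proof.
move=> ij; apply: mxact_inj => x; rewrite mxact_mul !mxact_givens.
apply: eq_from_tnth => k; rewrite !tnth_mktuple eqxx (eq_sym j) (negPf ij) eqxx.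
by case: eqP => _; [ring|case: eqP => _ //; ring].
Qed.

Lemma givens_tr i j c s : i != j -> (givens i j c s)^T = givens i j c (- s).
Proof.
move=> ij; apply/matrixP => k l; rewrite !mxE.
have ji : j == i = false by rewrite eq_sym (negPf ij).
case: (eqVneq k i) => [ki|ki]; last case: (eqVneq k j) => [kj|kj].
- subst k; case: (eqVneq l i) => [li|li]; last case: (eqVneq l j) => [lj|lj].
  + by subst l; rewrite ?eqxx ?(negPf ij) ?ji ?mulr0n ?mulr1n; ring.
  + by subst l; rewrite ?eqxx ?(negPf ij) ?ji ?mulr0n ?mulr1n; ring.
  + by rewrite !mulr0n; ring.
- subst k; case: (eqVneq l i) => [li|li]; last case: (eqVneq l j) => [lj|lj].
  + by subst l; rewrite ?eqxx ?(negPf ij) ?ji ?mulr0n ?mulr1n; ring.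
  + by subst l; rewrite ?eqxx ?(negPf ij) ?ji ?mulr0n ?mulr1n; ring.
  + by rewrite !mulr0n; ring.
- by case: (eqVneq l i) => [->|li]; last case: (eqVneq l j) => [->|lj];
    rewrite ?[i == k]eq_sym ?[j == k]eq_sym ?(negPf ki) ?(negPf kj) ?[k == l]eq_sym
      ?mulr0n; try ring.
Qed.

Lemma givens1 i j : givens i j 1 0 = 1%:M.
Proof.
apply/matrixP => k l; rewrite !mxE !mul0r !mul1r addr0 subr0 [k == l]eq_sym.
by case: eqP => [->//|_]; case: eqP => [->|].
Qed.

(* A rotation of the plane is the square of the rotation by half the angle,
   and the square of an orthogonal matrix has determinant 1. *)
Lemma rotation_givens i j c s : i != j -> c ^+ 2 + s ^+ 2 = 1 ->
  rotation (givens i j c s).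
Proof.
move=> ij; have orth u v : u ^+ 2 + v ^+ 2 = 1 ->
    givens i j u v *m (givens i j u v)^T = 1%:M.
  move=> uv1; rewrite givens_tr // givens_mul // -(givens1 i j).
  by congr givens; rewrite -?uv1; ring.
move=> cs1; split; first exact: orth.
suff [u [v [uv1 cE sE]]] : exists u v, [/\ u ^+ 2 + v ^+ 2 = 1,
    c = u * u - v * v & s = u * v + v * u].
  rewrite cE sE -givens_mul // det_mulmx -{2}det_tr -det_mulmx orth //.
  exact: det1.
(* The half angle has cosine [u] and sine [s / (2 * u)]. For [c = - 1] this [u] would be 0, and the
   square root is a quarter turn instead. *)
have [cN1|cN1] := eqVneq c (- 1).
  have s0 : s = 0 by apply/eqP; rewrite -sqrf_eq0; apply/eqP; move: cs1; rewrite cN1; lra.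
  by exists 0, 1; split; rewrite ?cN1 ?s0; ring.
have c_gtN1 : 0 < 1 + c.
  have : 0 <= 1 + c by nra.
  by rewrite le_eqVlt eq_sym addrC addr_eq0 (negPf cN1).
pose u := Num.sqrt ((1 + c) / 2).
have u2 : u ^+ 2 = (1 + c) / 2 by rewrite sqr_sqrtr //; lra.
have u0 : u != 0 by rewrite -sqrf_eq0 u2; lra.
exists u, (s / (2 * u)).
have s2 : s ^+ 2 = (1 - c) * (1 + c) by nra.
have v2 : (s / (2 * u)) ^+ 2 = (1 - c) / 2.
  by rewrite expr_div_n exprMn u2 s2; field; lra.
split; first by rewrite u2 v2; lra.
- by rewrite -!expr2 u2 v2; lra.
- by field.
Qed.

End Givens.

(** * Integrals of monomials over the sphere *)

Section SphereIntegral.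
Variables (R : realType) (n : nat).
Implicit Types (x : n.-tuple R) (e : 'I_n -> nat) (Q : 'M[R]_n).

Lemma measurable_monom e : measurable_fun setT (@monom R n e).
Proof.
apply: measurable_prod => i _; apply: measurable_funX.
exact: measurable_tnth.
Qed.

Lemma measurable_mxact Q : measurable_fun setT (mxact Q).
Proof.
apply/measurable_fun_tnthP => i.
rewrite (_ : _ \o _ = fun x => \sum_j Q i j * tnth x j); last first.
  by apply/funext => x; rewrite /= tnth_mktuple.
apply: measurable_sum => j; apply: measurable_funM; first exact: measurable_cst.
exact: measurable_tnth.
Qed.

Lemma measurable_sphere : measurable (@sphere R n).
Proof.
have mf : measurable_fun setT (fun x => \sum_i tnth x i ^+ 2).
  by apply: measurable_sum => i; apply: measurable_funX; exact: measurable_tnth.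
have := mf measurableT [set 1]%classic (measurable_set1 _).
by rewrite setTI.
Qed.

Lemma monom_sphere_le1 e x : sphere x -> `|monom e x| <= 1.
Proof.
move=> x1; rewrite normr_prod; apply: prodr_ile1 => i _.
rewrite normr_ge0 normrX exprn_ile1 //.
rewrite -(@ler_pXn2r _ 2) ?nnegrE // expr1n real_normK ?num_real //.
by rewrite -x1 (bigD1 i) //= lerDl sumr_ge0 // => j _; rewrite sqr_ge0.
Qed.

Lemma mxact_sphere Q x : Q *m Q^T = 1%:M -> sphere (mxact Q x) <-> sphere x.
Proof.
move=> QQ; suff E : \sum_i tnth (mxact Q x) i ^+ 2 = \sum_i tnth x i ^+ 2.
  by rewrite /sphere /= E.
have colE (y : n.-tuple R) : \sum_i tnth y i ^+ 2 =
    ((\col_i tnth y i)^T *m (\col_i tnth y i)) ord0 ord0.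
  by rewrite mxE; apply: eq_bigr => i _; rewrite !mxE.
have actE : \col_i tnth (mxact Q x) i = Q *m \col_i tnth x i.
  by apply/colP => i; rewrite !mxE tnth_mktuple; apply: eq_bigr => j _; rewrite mxE.
by rewrite !colE actE trmx_mul -mulmxA (mulmxA Q^T) (mulmx1C QQ) mul1mx.
Qed.

Variable sigma : probability (n.-tuple R) R.

Lemma integrable_sphere (f : n.-tuple R -> R) : measurable_fun setT f ->
  (forall x, sphere x -> `|f x| <= 1) -> sigma.-integrable (@sphere R n) (EFin \o f).
Proof.
move=> mf f1; apply: measurable_bounded_integrable; first exact: measurable_sphere.
- by rewrite (le_lt_trans (probability_le1 _ measurable_sphere)) // ltry.
- exact: measurable_funTS.
- exists 1; split; first exact: num_real.
  by move=> M M1 x sx; exact: le_trans (f1 x sx) (ltW M1).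
Qed.

Lemma integrable_monom e : sigma.-integrable (@sphere R n) (EFin \o monom e).
Proof. exact: integrable_sphere (measurable_monom e) (@monom_sphere_le1 e). Qed.

(** [fine] loses nothing: monomials are bounded by 1 on the sphere, hence integrable. *)
Definition sphere_moment e : R := fine (\int[sigma]_(x in @sphere R n) (monom e x)%:E).

Lemma integral_sum_monomials N (c : 'I_N -> R) (e : 'I_N -> 'I_n -> nat) :
  (\int[sigma]_(x in @sphere R n) (\sum_i c i * monom (e i) x)%:E =
   (\sum_i c i * sphere_moment (e i))%:E)%E.
Proof.
under eq_integral do rewrite -sumEFin.
rewrite integral_sum; [|exact: measurable_sphere|]; last first.
  move=> i; under eq_fun do rewrite EFinM.
  by apply: integrableZl; [exact: measurable_sphere|exact: integrable_monom].
rewrite -sumEFin; apply: eq_bigr => i _.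
under eq_integral do rewrite EFinM.
rewrite integralZl; [|exact: measurable_sphere|exact: integrable_monom].
rewrite EFinM fineK //; apply: integrable_fin_num; first exact: measurable_sphere.
exact: integrable_monom.
Qed.

Hypothesis unif : uniform_on_sphere sigma.

(** A change of variables: the sphere is its own preimage under [Q], and the pushforward of [sigma]
    agrees with [sigma] on measurable sets. *)
Lemma integral_monom_rotation Q e : rotation Q ->
  (\int[sigma]_(x in @sphere R n) (monom e (mxact Q x))%:E =
   \int[sigma]_(x in @sphere R n) (monom e x)%:E)%E.
Proof.
move=> rotQ; have [QQ _] := rotQ.
have preE : (mxact Q @^-1` @sphere R n = @sphere R n)%classic.
  by apply/seteqP; split => x /mxact_sphere; apply.
have mf : measurable_fun setT (EFin \o @monom R n e).
  by apply/measurable_EFinP; exact: measurable_monom.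
have intf : sigma.-integrable (mxact Q @^-1` @sphere R n)%classic
    ((EFin \o monom e) \o mxact Q).
  rewrite preE; apply: (@integrable_sphere (monom e \o mxact Q)).
    by apply: measurableT_comp; [exact: measurable_monom|exact: measurable_mxact].
  by move=> x /(mxact_sphere _ QQ); exact: monom_sphere_le1.
have := integral_pushforward (measurable_mxact Q) mf intf measurable_sphere.
rewrite preE => <-; apply: eq_measure_integral; first exact: measurable_mxact.
by move=> mQ A mA sA; have [_ inv] := unif; exact: inv.
Qed.

(** Each expansion of a rotated monomial thus yields a linear relation between moments. *)
Lemma sphere_moment_rotation Q e N (c : 'I_N -> R) (e' : 'I_N -> 'I_n -> nat) :
  rotation Q -> (forall x, monom e (mxact Q x) = \sum_l c l * monom (e' l) x) ->
  sphere_moment e = \sum_l c l * sphere_moment (e' l).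
Proof.
move=> rotQ eQ; rewrite /sphere_moment -(integral_monom_rotation e rotQ).
by under eq_integral do rewrite eQ; rewrite integral_sum_monomials.
Qed.

Lemma sphere_moment0 : sphere_moment (fun=> 0%N) = 1.
Proof.
rewrite /sphere_moment; under eq_integral do rewrite monom0.
rewrite integral_cst; last exact: measurable_sphere.
by have [s1 _] := unif; rewrite mul1e -[RHS]/(fine 1%E); congr fine; exact: s1.
Qed.

Lemma sphere_moment_sum e : \sum_i sphere_moment (addexp e (single 2 i)) = sphere_moment e.
Proof.
transitivity (\sum_i 1 * sphere_moment (addexp e (single 2 i))).
  by apply: eq_bigr => i _; rewrite mul1r.
apply: EFin_inj; rewrite -integral_sum_monomials [RHS]fineK; last first.
  by apply: integrable_fin_num; [exact: measurable_sphere|exact: integrable_monom].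
apply: eq_integral => x; rewrite inE => sx; congr EFin.
under eq_bigr do rewrite mul1r monom_addexp monom_single.
by rewrite -mulr_sumr sx mulr1.
Qed.

(** A transposition has determinant -1 and is no rotation; a quarter turn of the plane exchanges the
    two coordinates up to one sign, which accounts for the factor. *)
Lemma sphere_moment_quarter_turn e i j : i != j ->
  sphere_moment e = (-1) ^+ e j * sphere_moment (e \o tperm i j).
Proof.
move=> ij.
suff : sphere_moment e =
    \sum_(l < 1) (-1) ^+ e j * sphere_moment (e \o tperm i j) by rewrite big_ord1.
apply: (@sphere_moment_rotation (givens i j 0 1)) => [|x].
  by apply: rotation_givens => //; rewrite expr0n expr1n add0r.
rewrite big_ord1 mxact_givens monom_tperm /monom [LHS](bigD1 j) // [in RHS](bigD1 j) //=.
rewrite !tnth_mktuple eqxx eq_sym (negPf ij) tpermR mul0r mul1r sub0r mulrA -exprMn mulN1r.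
congr (_ * _); apply: eq_bigr => k kj; rewrite !tnth_mktuple (negPf kj).
by case: eqVneq => [->|ki]; [rewrite tpermL mul0r mul1r add0r|rewrite tpermD // eq_sym].
Qed.

Lemma sphere_moment_tperm e i j :
  sphere_moment (dblexp e \o tperm i j) = sphere_moment (dblexp e).
Proof.
have [->|ij] := eqVneq i j.
  by congr sphere_moment; apply/funext => k; rewrite /= tperm1 perm1.
by rewrite [RHS](sphere_moment_quarter_turn _ ij) -signr_odd odd_double mul1r.
Qed.

(* Two quarter turns flip the signs of two coordinates.  If all exponents are
   odd, two of them are equal to 1, and one quarter turn in that plane suffices. *)
Lemma sphere_moment_odd e i : (3 < n)%N -> odd (e i) -> (\sum_j e j <= 9)%N ->
  sphere_moment e = 0.
Proof.
move=> n3 oi e9; have Neq0 (t : R) : t = - t -> t = 0.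
  by move=> tN; apply/eqP; rewrite -eqNr -tN.
have [/existsP[j ej]|/existsPn all_odd] := boolP [exists j, ~~ odd (e j)].
  have ij : i != j by apply: contraNneq ej => <-.
  apply: Neq0; rewrite {1}(sphere_moment_quarter_turn _ ij).
  rewrite (sphere_moment_quarter_turn _ ij) /= tpermR mulrA -exprD.
  rewrite -signr_odd oddD oi (negPf ej) expr1 mulN1r; congr (- sphere_moment _).
  by apply/funext => k; rewrite /= tpermK.
have [j [k [jk ejk]]] : exists j k, j != k /\ e j = e k.
  apply/not_existsP => noeq.
  (* If no two of the odd exponents agree, at most one of them is 1 and the others are at least 3.
     With at least four coordinates the degree is then at least 1 + 3 * 3 = 10. *)
  have big k : (forall j, j != k -> 3 <= e j)%N -> False.
    move=> e3; have := e9; rewrite (bigD1 k) //= leqNgt => /negP; apply.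
    have := all_odd k; rewrite negbK => /odd_gt0 ek.
    apply: (@leq_trans (1 + \sum_(j < n | j != k) 3)%N); last first.
      by rewrite leq_add // leq_sum.
    by rewrite sum_nat_const cardC1 card_ord; move: n3; lia.
  have ge3 j : e j != 1%N -> (3 <= e j)%N.
    by have := all_odd j; rewrite negbK; case: (e j) => [|[|[]]].
  have [/existsP[k /eqP ek]|/existsPn no1] := boolP [exists k, e k == 1%N].
    apply: (big k) => j jk; apply: ge3; apply/eqP => ej.
    by apply: (noeq j); exists k; split=> //; rewrite ej.
  by apply: (big i) => j _; apply: ge3.
apply: Neq0; rewrite {1}(sphere_moment_quarter_turn _ jk) -signr_odd.
have := all_odd k; rewrite negbK => ->; rewrite expr1 mulN1r; congr (- sphere_moment _).
by apply/funext => l /=; case: tpermP => [->|->|].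
Qed.

Lemma symmetric_sphere_moments_sphere : (3 < n)%N ->
  symmetric_sphere_moments 9 sphere_moment.
Proof.
move=> n3; split=> [e i|e i j|e].
- exact: sphere_moment_odd.
- exact: sphere_moment_tperm.
- exact: sphere_moment_sum.
Qed.

(** Binomial expansion of the k-th power of the rotated coordinate c x_i + s x_j. *)
Lemma sphere_moment_rotation_single k i j (c s : R) : i != j -> c ^+ 2 + s ^+ 2 = 1 ->
  sphere_moment (single k i) = \sum_(l < k.+1) (c ^+ (k - l) * s ^+ l *+ 'C(k, l)) *
    sphere_moment (addexp (single (k - l) i) (single l j)).
Proof.
move=> ij cs; apply: (@sphere_moment_rotation (givens i j c s)) => [|x].
  exact: rotation_givens.
rewrite mxact_givens monom_single tnth_mktuple eqxx exprDn; apply: eq_bigr => l _.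
rewrite monom_addexp !monom_single !exprMn mulrnAl; congr (_ *+ _).
by rewrite mulrACA.
Qed.


End SphereIntegral.

(** * Values of the moments of the uniform measure *)

Section SphereMomentValues.
Variables (R : realType) (n : nat) (sigma : probability (n.-tuple R) R).
Hypotheses (unif : uniform_on_sphere sigma) (n3 : (3 < n)%N).
Implicit Types (i j : 'I_n).

Local Notation mu := (sphere_moment sigma).
Local Notation pair k l i j := (addexp (single k i) (single l j)).

Let pair_odd k l i j : i != j -> odd k || odd l -> (k + l <= 9)%N -> mu (pair k l i j) = 0.
Proof.
move=> ij okl kl9; case/orP: okl => [ok|ol].
- apply: (sphere_moment_odd unif (i := i)) => //; last by rewrite sum_addexp !sum_single.
  by rewrite /addexp /single eqxx (negPf ij) addn0.
- apply: (sphere_moment_odd unif (i := j)) => //; last by rewrite sum_addexp !sum_single.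
  by rewrite /addexp /single eqxx eq_sym (negPf ij).
Qed.

Let pairC k l i j : mu (pair k.*2 l.*2 i j) = mu (pair l.*2 k.*2 i j).
Proof.
rewrite -!dblexp_single -!dblexp_add -(sphere_moment_tperm unif _ i j); congr mu.
apply/funext => m; rewrite /dblexp /addexp /= -[single k i _]/((single k i \o _) m).
by rewrite -[single l j _]/((single l j \o _) m) !single_tperm tpermL tpermR addnC.
Qed.

Let pair0r k i j : pair k 0 i j = single k i.
Proof. by apply/funext => m; rewrite /addexp /single if_same addn0. Qed.

Let pair0l k i j : pair 0 k i j = single k j.
Proof. by apply/funext => m; rewrite /addexp /single if_same. Qed.

Let single_const k i j : mu (single k.*2 i) = mu (single k.*2 j).
Proof.
rewrite -!dblexp_single.
by apply: (@nu_single _ _ (mu \o @dblexp n)) => b i' j'; exact: sphere_moment_tperm.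
Qed.

(** The Pythagorean triple 3, 4, 5 gives a rotation with rational entries. Terms with odd exponents
    vanish, leaving one linear equation between the two moments. *)
Let rel4 i j : i != j -> mu (single 4 i) = 3 * mu (pair 2 2 i j).
Proof.
move=> ij.
have := @sphere_moment_rotation_single _ _ _ unif 4 i j (3 / 5) (4 / 5) ij.
have -> : (3 / 5) ^+ 2 + (4 / 5) ^+ 2 = 1 :> R by field.
rewrite !big_ord_recr big_ord0 /= => /(_ erefl).
rewrite pair0r pair0l [mu (single 4 j)](single_const 2 j i).
rewrite (pair_odd ij (k := 3)) // (pair_odd ij (k := 1)) //.
rewrite (_ : 'C(4, 0) = 1%N) // (_ : 'C(4, 2) = 6%N) // (_ : 'C(4, 4) = 1%N) //.
lra.
Qed.

Let rel6 i j : i != j -> mu (single 6 i) = 5 * mu (pair 4 2 i j).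
Proof.
move=> ij.
have := @sphere_moment_rotation_single _ _ _ unif 6 i j (3 / 5) (4 / 5) ij.
have -> : (3 / 5) ^+ 2 + (4 / 5) ^+ 2 = 1 :> R by field.
rewrite !big_ord_recr big_ord0 /= => /(_ erefl).
rewrite pair0r pair0l [mu (single 6 j)](single_const 3 j i) (pairC 1 2).
rewrite (pair_odd ij (k := 5)) // (pair_odd ij (k := 3)) // (pair_odd ij (k := 1)) //.
rewrite (_ : 'C(6, 0) = 1%N) // (_ : 'C(6, 2) = 15%N) // (_ : 'C(6, 4) = 15%N) //.
rewrite (_ : 'C(6, 6) = 1%N) //.
lra.
Qed.

Let rotation8 i j (c s : R) : i != j -> c ^+ 2 + s ^+ 2 = 1 ->
  mu (single 8 i) = c ^+ 8 * mu (single 8 i) + c ^+ 6 * s ^+ 2 *+ 28 * mu (pair 6 2 i j)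
    + c ^+ 4 * s ^+ 4 *+ 70 * mu (pair 4 4 i j)
    + c ^+ 2 * s ^+ 6 *+ 28 * mu (pair 6 2 i j) + s ^+ 8 * mu (single 8 i).
Proof.
move=> ij cs; rewrite {1}(sphere_moment_rotation_single unif 8 ij cs).
rewrite !big_ord_recr big_ord0 /= pair0r pair0l [mu (single 8 j)](single_const 4 j i).
rewrite (pairC 1 3) (pair_odd ij (k := 7)) // (pair_odd ij (k := 5)) //.
rewrite (pair_odd ij (k := 3)) // (pair_odd ij (k := 1)) //.
rewrite (_ : 'C(8, 0) = 1%N) // (_ : 'C(8, 2) = 28%N) // (_ : 'C(8, 4) = 70%N) //.
rewrite (_ : 'C(8, 6) = 28%N) // (_ : 'C(8, 8) = 1%N) //.
by rewrite !mulr0 !addr0 !mulr1n !subn0 add0r !expr0 mul1r mulr1.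
Qed.

(** Degree 8 has two mixed moments, so two relations are needed; they come from the triples 3, 4, 5
    and 5, 12, 13. *)
Let rel8 i j : i != j ->
  mu (single 8 i) = 7 * mu (pair 6 2 i j) /\ 5 * mu (pair 4 4 i j) = 3 * mu (pair 6 2 i j).
Proof.
move=> ij.
have := @rotation8 i j (3 / 5) (4 / 5) ij.
have -> : (3 / 5) ^+ 2 + (4 / 5) ^+ 2 = 1 :> R by field.
move=> /(_ erefl) r1.
have := @rotation8 i j (5 / 13) (12 / 13) ij.
have -> : (5 / 13) ^+ 2 + (12 / 13) ^+ 2 = 1 :> R by field.
move=> /(_ erefl) r2.
split; lra.
Qed.

Let N_gt3 : 3 < n%:R :> R.
Proof. by rewrite (ltr_nat R 3). Qed.

(** In the sum rule for [single k i], the term at [i] is the moment of degree k + 2, and by [rel]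
    each of the other n - 1 terms is that moment divided by k + 1. *)
Let moment_rec k i : (forall j, i != j ->
    mu (single k.+2 i) = k.+1%:R * mu (pair k 2 i j)) ->
  mu (single k.+2 i) = k.+1%:R / (n%:R + k%:R) * mu (single k i).
Proof.
move=> rel; have k0 : 0 <= k%:R :> R by [].
rewrite -[in RHS](sphere_moment_sum sigma) (bigD1 i) //= addexp_single addn2.
rewrite (eq_bigr (fun=> mu (single k.+2 i) / k.+1%:R)) => [|j ji]; last first.
  by rewrite (rel j) 1?eq_sym // mulrC mulKf // pnatr_eq0.
have N3 := N_gt3; rewrite sumr_const cardC1 card_ord -[_ *+ n.-1]mulr_natl -subn1 natrB.
  by rewrite -natr1; field; rewrite !lt0r_neq0 //; lra.
exact: leq_trans n3.
Qed.

Let moment2 i : mu (single 2 i) = n%:R^-1.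
Proof.
rewrite (@moment_rec 0 i) => [|j ij].
  rewrite (_ : single 0 i = fun=> 0%N); last by apply/funext => j; rewrite /single if_same.
  by rewrite sphere_moment0 // addr0 mulr1 mul1r.
by rewrite pair0l mul1r (single_const 1 i j).
Qed.

Let moment4 i : mu (single 4 i) = 3 / (n%:R * (n%:R + 2)).
Proof.
rewrite (moment_rec (rel4 (i := i))) moment2.
by field; rewrite !lt0r_neq0 //; have := N_gt3; lra.
Qed.

Let moment6 i : mu (single 6 i) = 15 / (n%:R * (n%:R + 2) * (n%:R + 4)).
Proof.
rewrite (moment_rec (rel6 (i := i))) moment4.
by field; rewrite !lt0r_neq0 //; have := N_gt3; lra.
Qed.

Let moment8 i : mu (single 8 i) =
  105 / (n%:R * (n%:R + 2) * (n%:R + 4) * (n%:R + 6)).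
Proof.
rewrite (moment_rec (fun j ij => (rel8 ij).1)) moment6.
by field; rewrite !lt0r_neq0 //; have := N_gt3; lra.
Qed.

Let sum_const k i : \sum_j mu (single k.*2 j) = n%:R * mu (single k.*2 i).
Proof.
rewrite (eq_bigr (fun=> mu (single k.*2 i))) => [|j _]; last exact: single_const.
by rewrite sumr_const card_ord mulr_natl.
Qed.

Let i0 : 'I_n := Ordinal (ltn_trans (isT : 0 < 3)%N n3).
Let j0 : 'I_n := Ordinal (ltn_trans (isT : 1 < 3)%N n3).

Lemma sum_sphere_moment4 : \sum_i mu (single 4 i) = 3 / (n%:R + 2).
Proof.
rewrite (sum_const 2 i0) moment4.
by field; rewrite !lt0r_neq0 //; have := N_gt3; lra.
Qed.

Lemma sum_sphere_moment6 :
  \sum_i mu (single 6 i) = 15 / ((n%:R + 2) * (n%:R + 4)).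
Proof.
rewrite (sum_const 3 i0) moment6.
by field; rewrite !lt0r_neq0 //; have := N_gt3; lra.
Qed.

Lemma sum_sphere_moment8 :
  \sum_i mu (single 8 i) = 105 / ((n%:R + 2) * (n%:R + 4) * (n%:R + 6)).
Proof.
rewrite (sum_const 4 i0) moment8.
by field; rewrite !lt0r_neq0 //; have := N_gt3; lra.
Qed.

Lemma sum_sphere_moment44 :
  \sum_i \sum_j mu (pair 4 4 i j) =
  (9 * n%:R + 96) / ((n%:R + 2) * (n%:R + 4) * (n%:R + 6)).
Proof.
have ij : i0 != j0 by [].
transitivity (\sum_i \sum_j (mu \o @dblexp n) (pair 2 2 i j)).
  by apply: eq_bigr => i _; apply: eq_bigr => j _; rewrite /= dblexp_add !dblexp_single.
rewrite (sum_nu_pair _ 2 ij) /=; last by move=> b i j; exact: sphere_moment_tperm.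
rewrite dblexp_add !dblexp_single moment8.
have [r1 r2] := rel8 ij; have m8 := moment8 i0.
(* 3 / 35 is the product of 3 / 5 and 1 / 7, the two ratios in [rel8]. *)
have -> : mu (pair 4 4 i0 j0) = 3 / 35 * mu (single 8 i0) by lra.
by rewrite m8; field; rewrite !lt0r_neq0 //; have := N_gt3; lra.
Qed.

End SphereMomentValues.

(** For the side conditions of [field]: each factor of a denominator is shown to be positive. *)
Ltac neq0_lra :=
  repeat (apply/andP; split); apply: lt0r_neq0; lra.

(** * Reduction of the rule to equations in the weights, and their solution *)

Section Cubature.
Variable R : realType.

(** The right-hand sides are the values for the uniform measure. Both sides of the rule then agree
    on all monomials of degree at most 9, and linearity gives the polynomials. *)
Lemma symmetric_cubature9 n (I : finType) (l : I -> R) (y : I -> n.-tuple R)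
    (sigma : probability (n.-tuple R) R) (f : Mpoly.poly n R) :
  uniform_on_sphere sigma -> (3 < n)%N ->
  (forall a, power_sum 2 (y a) = 1) ->
  \sum_a l a = 1 ->
  \sum_a l a * power_sum 4 (y a) = 3 / (n%:R + 2) ->
  \sum_a l a * power_sum 6 (y a) = 15 / ((n%:R + 2) * (n%:R + 4)) ->
  \sum_a l a * power_sum 8 (y a) = 105 / ((n%:R + 2) * (n%:R + 4) * (n%:R + 6)) ->
  \sum_a l a * power_sum 4 (y a) ^+ 2 =
    (9 * n%:R + 96) / ((n%:R + 2) * (n%:R + 4) * (n%:R + 6)) ->
  Mpoly.degree_le 9 f ->
  (\int[sigma]_(x in @sphere R n) (Mpoly.eval f x)%:E =
   (\sum_a l a * orbit_avg f (y a))%:E)%E.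
Proof.
move=> unif n3 y1 l1 l4 l6 l8 l44 f9.
have [N [c [e [e9 fE]]]] := PolynomialExpansion.eval_sum_monomials f9.
have rule_eq b : (\sum_i b i <= 9)%N ->
    sphere_moment sigma b = \sum_a l a * orbit_moment (y a) b.
  move: b; apply: (@symmetric_sphere_moments_eq _ _ _
    (fun b => \sum_a l a * orbit_moment (y a) b)).
  - exact: symmetric_sphere_moments_sphere.
  - by apply: symmetric_sphere_moments_lincomb => a; exact: orbit_symmetric_moments.
  - rewrite sphere_moment0 // -l1; apply: eq_bigr => a _.
    by rewrite orbit_moment0 mulr1.
  - rewrite sum_sphere_moment4 // -l4 exchange_big; apply: eq_bigr => a _.
    by rewrite -mulr_sumr (sum_orbit_moment_single 2).
  - rewrite sum_sphere_moment6 // -l6 exchange_big; apply: eq_bigr => a _.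
    by rewrite -mulr_sumr (sum_orbit_moment_single 3).
  - rewrite sum_sphere_moment8 // -l8 exchange_big; apply: eq_bigr => a _.
    by rewrite -mulr_sumr (sum_orbit_moment_single 4).
  - rewrite sum_sphere_moment44 // -l44.
    under [RHS]eq_bigr do rewrite exchange_big.
    rewrite exchange_big; apply: eq_bigr => a _.
    under eq_bigr do rewrite -mulr_sumr.
    by rewrite -mulr_sumr (sum_orbit_moment_pair 2).
under eq_integral do rewrite fE.
rewrite integral_sum_monomials; congr EFin.
under eq_bigr do rewrite rule_eq // mulr_sumr.
rewrite exchange_big; apply: eq_bigr => a _.
rewrite -[orbit_avg f _]/(fun_orbit_avg (Mpoly.eval f) (y a)).
rewrite (eq_fun_orbit_avg (G := fun z => \sum_i c i * monom (e i) z)) => [|z _];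
  last exact: fE.
rewrite fun_orbit_avg_sum mulr_sumr; apply: eq_bigr => i _.
by rewrite fun_orbit_avgZ mulrCA.
Qed.

Lemma power_sum_scale n k c (x : n.-tuple R) :
  power_sum k (scale_pt c x) = c ^+ k * power_sum k x.
Proof.
by rewrite /power_sum mulr_sumr; apply: eq_bigr => i _; rewrite tnth_mktuple exprMn.
Qed.

(** The exponent is taken positive because [0 ^+ 0] is 1: at exponent 0 the zero entries would count
    too. *)
Lemma power_sum_vpt n k j : (k <= n)%N -> power_sum j.+1 (vpt n k) = k%:R :> R.
Proof.
move=> kn; rewrite /power_sum.
under eq_bigr do rewrite tnth_mktuple.
rewrite (eq_bigr (fun i : 'I_n => if (i < k)%N then 1 else 0 : R)) => [|i _]; last first.
  by case: ifP; rewrite ?expr1n // expr0n.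
rewrite -big_mkcond /= (big_ord_narrow kn) sumr_const card_ord //.
Qed.

Lemma power_sum_scaled_vpt n k j : (0 < k <= n)%N ->
  power_sum j.+1.*2 (scale_pt (Num.sqrt k%:R)^-1 (vpt n k)) = k%:R^-1 ^+ j :> R.
Proof.
move=> /andP[k0 kn]; rewrite power_sum_scale doubleS power_sum_vpt // -doubleS -mul2n exprM.
by rewrite [_^-1 ^+ 2]exprVn sqr_sqrtr // exprSr mulfVK // pnatr_eq0 -lt0n.
Qed.

Lemma power_sum_apt d j (a : R) : 0 <= a ->
  power_sum j.*2 (apt d.+1 a) = a ^+ j + d%:R.
Proof.
move=> a0; rewrite /power_sum big_ord_recl tnth_mktuple /= -mul2n exprM sqr_sqrtr //.
congr (_ + _); rewrite (eq_bigr (fun=> 1)) => [|i _]; last by rewrite tnth_mktuple expr1n.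
by rewrite sumr_const card_ord.
Qed.

Lemma power_sum_scaled_apt d j (a : R) : 0 <= a ->
  power_sum j.*2 (scale_pt (Num.sqrt (a + d%:R))^-1 (apt d.+1 a)) =
  (a ^+ j + d%:R) / (a + d%:R) ^+ j.
Proof.
move=> a0; rewrite power_sum_scale power_sum_apt // -mul2n exprM.
rewrite [_^-1 ^+ 2]exprVn sqr_sqrtr ?addr_ge0 //.
by rewrite mulrC exprVn.
Qed.

(* Here [N] is d + 1 and [M] is m; [spike] is the parameter a of the paper, and
   [weight_all], [weight_axes], [weight_ones], [weight_spike] are lambda_1,
   lambda_2, lambda_4, lambda_5, obtained by solving the linear system of
   [sum_weights] and [weights_power_sum4] to [weights_power_sum44]. *)
Section Weights.
Variables N M : R.

Definition spike : R := 3 * (N - 1 - M) / (N + 3 - 3 * M).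

Local Notation s := (spike + (N - 1)).
Local Notation C := ((N + 2) * (N + 4) * (N + 6)).

Definition weight_all_numerator : R :=
  - (N ^+ 4 + 16 * N ^+ 3 - 9 * M * N ^+ 3 + 27 * M ^+ 2 * N ^+ 2
     - 108 * M * N ^+ 2 + 81 * N ^+ 2 - 27 * N * M ^+ 3 + 180 * N * M ^+ 2
     - 225 * N * M + 54 * N - 216 * M ^+ 2 + 594 * M - 432).

Definition weight_axes_numerator : R :=
  - N ^+ 2 + 18 * M * N - 54 * M ^+ 2 + 108 * M - 15 * N - 54.

Definition weight_all : R :=
  N ^+ 3 * weight_all_numerator / (2 * (N - 3) ^+ 2 * (N - M) * C).

Definition weight_axes : R :=
  4 * weight_axes_numerator / ((M - 1) * (N + 3 - 3 * M) * C).

Definition weight_ones : R :=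
  4 * M ^+ 3 * ((N - 1) * (N - 2) * (N - 3)) / ((M - 1) * (N - M) * (N - M - 1) * C).

Definition weight_spike : R := 6 * s ^+ 4 / (spike * (spike - 1) ^+ 2 * C).

(** These inequalities make every denominator in the weights and in their equations positive; the
    last one concerns the numerator of [s], see [sE]. *)
Definition weight_range : Prop :=
  [/\ 1 < M, 0 < N + 3 - 3 * M, 0 < N - M - 1, 3 < N
    & 0 < (N - 1) * (N + 6) - 3 * M * N].

Lemma spike_gt0 : weight_range -> 0 < spike.
Proof. by move=> [M1 D0 MN N3 s0]; apply: divr_gt0 => //; apply: mulr_gt0; lra. Qed.

Let C_gt0 : 3 < N -> 0 < C.
Proof. by move=> N3; apply: mulr_gt0; [apply: mulr_gt0|]; lra. Qed.

Lemma weight_ones_ge0 : weight_range -> 0 <= weight_ones.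
Proof.
move=> [M1 D0 MN N3 s0]; apply: divr_ge0.
  apply: mulr_ge0; first by rewrite mulr_ge0 // exprn_ge0 //; lra.
  by apply: mulr_ge0; [apply: mulr_ge0|]; lra.
by apply: mulr_ge0; [apply: mulr_ge0; [apply: mulr_ge0|]; lra|exact/ltW/C_gt0].
Qed.

Lemma weight_spike_ge0 : weight_range -> 0 <= weight_spike.
Proof.
move=> W; have [M1 D0 MN N3 s0] := W; apply: divr_ge0.
  by rewrite mulr_ge0 // -[4%N]/(2 * 2)%N exprM sqr_ge0.
apply: mulr_ge0; last exact/ltW/C_gt0.
by rewrite mulr_ge0 ?sqr_ge0 // ltW // spike_gt0.
Qed.

Lemma weight_all_ge0 : weight_range -> 0 <= weight_all_numerator -> 0 <= weight_all.
Proof.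
move=> [M1 D0 MN N3 s0] num0; apply: divr_ge0.
  by rewrite mulr_ge0 // exprn_ge0 //; lra.
apply: mulr_ge0; last exact/ltW/C_gt0.
by apply: mulr_ge0; [rewrite mulr_ge0 ?sqr_ge0|lra].
Qed.

Lemma weight_axes_ge0 : weight_range -> 0 <= weight_axes_numerator -> 0 <= weight_axes.
Proof.
move=> [M1 D0 MN N3 s0] num0; apply: divr_ge0; first by rewrite mulr_ge0.
by apply: mulr_ge0; [apply: mulr_ge0; lra|exact/ltW/C_gt0].
Qed.

(** This form and the next one are factored, so that [field] meets only denominators whose sign is
    given by [weight_range]. *)
Let sE : N + 3 - 3 * M != 0 ->
  s = ((N - 1) * (N + 6) - 3 * M * N) / (N + 3 - 3 * M).
Proof. by move=> D0; rewrite /spike; field. Qed.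

Let spike1E : N + 3 - 3 * M != 0 -> spike - 1 = 2 * (N - 3) / (N + 3 - 3 * M).
Proof. by move=> D0; rewrite /spike; field. Qed.

Ltac unfold_weights W :=
  have [M1 D0 MN N3 s0] := W;
  rewrite /weight_all /weight_axes /weight_ones /weight_spike
    sE ?lt0r_neq0 // spike1E ?lt0r_neq0 //;
  rewrite /spike /weight_all_numerator /weight_axes_numerator.

Lemma sum_weights : weight_range ->
  weight_all + weight_axes + weight_ones + weight_spike = 1.
Proof. by move=> W; unfold_weights W; field; neq0_lra. Qed.

(** The exponent 1 is written out to match the output of [power_sum_scaled_vpt]. *)
Lemma weights_power_sum4 : weight_range ->
  weight_all * N^-1 ^+ 1 + weight_axes + weight_ones * M^-1 ^+ 1
    + weight_spike * ((spike ^+ 2 + (N - 1)) / s ^+ 2) = 3 / (N + 2).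
Proof. by move=> W; unfold_weights W; field; neq0_lra. Qed.

Lemma weights_power_sum6 : weight_range ->
  weight_all * N^-1 ^+ 2 + weight_axes + weight_ones * M^-1 ^+ 2
    + weight_spike * ((spike ^+ 3 + (N - 1)) / s ^+ 3) = 15 / ((N + 2) * (N + 4)).
Proof. by move=> W; unfold_weights W; field; neq0_lra. Qed.

Lemma weights_power_sum8 : weight_range ->
  weight_all * N^-1 ^+ 3 + weight_axes + weight_ones * M^-1 ^+ 3
    + weight_spike * ((spike ^+ 4 + (N - 1)) / s ^+ 4) = 105 / C.
Proof. by move=> W; unfold_weights W; field; neq0_lra. Qed.

(** The fifth equation on four weights; the choice of [spike] makes it compatible with the
    others. *)
Lemma weights_power_sum44 : weight_range ->
  weight_all * (N^-1 ^+ 1) ^+ 2 + weight_axes + weight_ones * (M^-1 ^+ 1) ^+ 2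
    + weight_spike * ((spike ^+ 2 + (N - 1)) / s ^+ 2) ^+ 2 = (9 * N + 96) / C.
Proof. by move=> W; unfold_weights W; field; neq0_lra. Qed.

End Weights.
(** Only [weight_all] and [weight_axes] need a sign condition, as the other two weights are
    nonnegative throughout [weight_range]. *)
Lemma positive_cubature9_of_weight_range d m (a : R) :
  (0 < m <= d.+1)%N -> (2 < d)%N -> weight_range d.+1%:R m%:R ->
  a = spike d.+1%:R m%:R ->
  0 <= weight_all_numerator d.+1%:R m%:R ->
  0 <= weight_axes_numerator d.+1%:R m%:R ->
  positive_cubature9 d m a.
Proof.
move=> md d2 W aE all0 axes0.
have a0 : 0 < a by rewrite aE; exact: spike_gt0.
have dE : d%:R = d.+1%:R - 1 :> R by rewrite -natr1 addrK.
set N := d.+1%:R in W aE all0 axes0 dE *; set M := m%:R in W aE all0 axes0 *.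
pose l := [:: weight_all N M; weight_axes N M; weight_ones N M; weight_spike N M].
pose y : seq (d.+1.-tuple R) :=
  [:: scale_pt (Num.sqrt N)^-1 (vpt d.+1 d.+1); vpt d.+1 1;
      scale_pt (Num.sqrt M)^-1 (vpt d.+1 m);
      scale_pt (Num.sqrt (a + d%:R))^-1 (apt d.+1 a)].
exists l`_0, l`_1, l`_2, l`_3; split; last split.
- by split; [exact: weight_all_ge0|exact: weight_axes_ge0|exact: weight_ones_ge0
            |exact: weight_spike_ge0].
- exact: sum_weights.
(* The default value for [nth], never reached by the four indices. *)
pose z := [tuple 0 | _ < d.+1] : d.+1.-tuple R.
(* The values 0, 1, 2, 3 of [j] give p2, p4, p6 and p8. *)
have psE j : [/\ power_sum j.+1.*2 (nth z y 0) = N^-1 ^+ j,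
    power_sum j.+1.*2 (nth z y 1) = 1,
    power_sum j.+1.*2 (nth z y 2) = M^-1 ^+ j &
    power_sum j.+1.*2 (nth z y 3) = (a ^+ j.+1 + (N - 1)) / (a + (N - 1)) ^+ j.+1].
  split; rewrite /y /=.
  - by rewrite power_sum_scaled_vpt // ltnSn.
  - exact: power_sum_vpt.
  - exact: power_sum_scaled_vpt.
  - by rewrite power_sum_scaled_apt ?dE // ltW.
move=> sigma unif f f9.
rewrite (@symmetric_cubature9 _ _ (fun i : 'I_4 => l`_i) (fun i => nth z y i) _ _ unif) //.
- by rewrite !big_ord_recr big_ord0 /= add0r.
- have [p0 p1 p2 p3] := psE 0%N.
  move=> [[|[|[|[|//]]]] i4] /=.
  + by rewrite p0.
  + by rewrite p1.
  + by rewrite p2.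
  + by rewrite p3 !expr1 divff // lt0r_neq0 // -dE ltr_wpDr.
- by rewrite !big_ord_recr big_ord0 /= add0r; exact: sum_weights.
- have [p0 p1 p2 p3] := psE 1%N.
  rewrite !big_ord_recr big_ord0 /= add0r p0 p1 p2 p3 mulr1 aE.
  exact: weights_power_sum4.
- have [p0 p1 p2 p3] := psE 2%N.
  rewrite !big_ord_recr big_ord0 /= add0r p0 p1 p2 p3 mulr1 aE.
  exact: weights_power_sum6.
- have [p0 p1 p2 p3] := psE 3%N.
  rewrite !big_ord_recr big_ord0 /= add0r p0 p1 p2 p3 mulr1 aE.
  exact: weights_power_sum8.
- have [p0 p1 p2 p3] := psE 1%N.
  rewrite !big_ord_recr big_ord0 /= add0r p0 p1 p2 p3 expr1n mulr1 aE.
  exact: weights_power_sum44.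
Qed.

(** Once N is replaced by 4m - 5, 4m - 6 or 4m - 7, both numerators are polynomials in m alone,
    whose signs are settled on each range. *)
Lemma admissible_positive_cubature9 d m (a : R) :
  admissible d m a -> positive_cubature9 d m a.
Proof.
have natE k : (3 <= m)%N -> (k <= 4 * m)%N -> (4 * m - k).+1%:R = 4 * m%:R + 1 - k%:R :> R.
  by move=> m3 km; rewrite -natr1 natrB // natrM addrAC.
case=> [[dE /andP[m3 m8] aE]|[dE /andP[m6 m11] aE]|[dE mE aE]].
- have NE : d.+1%:R = 4 * m%:R - 5 :> R by rewrite dE natE; [lra|lia|lia].
  have M3 : 3 <= m%:R :> R by rewrite (ler_nat R 3).
  have M8 : m%:R <= 8 :> R by rewrite (ler_nat R _ 8).
  apply: positive_cubature9_of_weight_range; rewrite ?NE; [lia|lia| | | |].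
  + by split; [lra|lra|lra|lra|nra].
  + by rewrite aE /spike; field; neq0_lra.
  (* The quadratic factor is positive for m from 3 to 8 and negative at m = 9. *)
  + rewrite (_ : weight_all_numerator _ _ =
      (m%:R - 2) ^+ 2 * (13 + 33 * m%:R - 4 * m%:R ^+ 2) :> R).
      by rewrite mulr_ge0 ?sqr_ge0 //; nra.
    by rewrite /weight_all_numerator; ring.
  + rewrite (_ : weight_axes_numerator _ _ = 2 * (m%:R + 1) * (m%:R - 2) :> R).
      by rewrite mulr_ge0 ?mulr_ge0 //; lra.
    by rewrite /weight_axes_numerator; ring.
- have NE : d.+1%:R = 4 * m%:R - 6 :> R by rewrite dE natE; [lra|lia|lia].
  have M6 : 6 <= m%:R :> R by rewrite (ler_nat R 6).
  have M11 : m%:R <= 11 :> R by rewrite (ler_nat R _ 11).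
  apply: positive_cubature9_of_weight_range; rewrite ?NE; [lia|lia| | | |].
  + by split; [lra|lra|lra|lra|nra].
  + by rewrite aE /spike; field; neq0_lra.
  (* The last factor is 1 at m = 11 and negative at m = 12, whence the upper bound. *)
  + rewrite (_ : weight_all_numerator _ _ =
      2 * (m%:R * (m%:R - 2)) * (27 * m%:R - 2 * m%:R ^+ 2 - 54) :> R).
      by rewrite !mulr_ge0 //; nra.
    by rewrite /weight_all_numerator; ring.
  (* The root m = 6 is the lower end of the range; there the axis points carry weight 0. *)
  + rewrite (_ : weight_axes_numerator _ _ = 2 * (m%:R * (m%:R - 6)) :> R).
      by rewrite !mulr_ge0 //; lra.
    by rewrite /weight_axes_numerator; ring.
- have m11 : (11 <= m <= 13)%N by move: mE; rewrite !inE => /or3P[]/eqP->.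
  have NE : d.+1%:R = 4 * m%:R - 7 :> R by rewrite dE natE; [lra|lia|lia].
  have M11 : 11 <= m%:R :> R by rewrite (ler_nat R 11); lia.
  have M13 : m%:R <= 13 :> R by rewrite (ler_nat R _ 13); lia.
  apply: positive_cubature9_of_weight_range; rewrite ?NE; [lia|lia| | | |].
  + by split; [lra|lra|lra|lra|nra].
  + by rewrite aE /spike; field; neq0_lra.
  + rewrite /weight_all_numerator.
    by move: mE; rewrite !inE => /or3P[]/eqP->; lra.
  (* The quadratic factor is 1 at m = 11 but negative at m = 10. *)
  + rewrite (_ : weight_axes_numerator _ _ = 2 * (m%:R ^+ 2 - 11 * m%:R + 1) :> R).
      by rewrite mulr_ge0 //; nra.
    by rewrite /weight_axes_numerator; ring.
Qed.

End Cubature.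

Theorem mainTheorem7 (R : realType) :
  (forall (d m : nat) (a : R), admissible d m a -> positive_cubature9 d m a) /\
  (forall d : nat,
     d \in [:: 6; 10; 14; 17; 18; 21; 22; 25; 26; 29; 33; 36; 37; 40; 44]%N ->
     exists (m : nat) (a : R), admissible d m a /\ positive_cubature9 d m a).
Proof.
split=> [|d dE]; first exact: admissible_positive_cubature9.
suff [m [a adm]] : exists (m : nat) (a : R), admissible d m a.
  by exists m, a; split; last exact: admissible_positive_cubature9.
have case1 k : (3 <= k <= 8)%N -> d = (4 * k - 6)%N ->
    exists (m : nat) (a : R), admissible d m a.
  by move=> k38 dk; exists k, 9; constructor 1.
have case2 k : (6 <= k <= 11)%N -> d = (4 * k - 7)%N ->
    exists (m : nat) (a : R), admissible d m a.
  by move=> k611 dk; exists k; eexists; constructor 2.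
have case3 k : k \in [:: 11; 12; 13]%N -> d = (4 * k - 8)%N ->
    exists (m : nat) (a : R), admissible d m a.
  by move=> k3 dk; exists k; eexists; constructor 3.
move: dE; rewrite !inE.
(* The residue of [d] modulo 4, which is 2, 1 or 0, selects the case; an exact division then
   recovers m, and a wrong case fails its range or equation. *)
repeat (case/orP; first (move/eqP => dE; first
  [ by apply: (case1 ((d + 6) %/ 4)%N); rewrite dE
  | by apply: (case2 ((d + 7) %/ 4)%N); rewrite dE
  | by apply: (case3 ((d + 8) %/ 4)%N); rewrite dE ])).
by move/eqP => dE; apply: (case3 13%N).
Qed.
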